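(* Let $SB$ be the Segal-Bargmann transform on $L_2(\mathbb{R})$ defined by $SB[f](z)=\int_{\mathbb{R}}\mathcal{A}(z,u)f(u)\,du$, $z\in\mathbb{C}$, with $\mathcal{A}(z,u)=e^{-\frac{u^2}{2}+\sqrt2uz-\frac{z^2}{2}}$. Then for every $f\in L_2(\mathbb{R})$ the function $SB[f]$ is holomorphic on $\mathbb{C}$, and the map $f\mapsto SB[f]$ is injective on $L_2(\mathbb{R})$.
   Context: $L_2(\mathbb{R})$ is the space of complex-valued square-integrable functions with respect to Lebesgue measure. *)

(* Defs.v *)
From HB Require Import structures.
From mathcomp Require Import all_boot all_order all_algebra.
From mathcomp Require Import all_classical all_reals all_analysis.
From mathcomp Require Import complex.
Set Implicit Arguments.
Unset Strict Implicit.
Unset Printing Implicit Defensive.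
Import Order.TTheory GRing.Theory Num.Theory.
Import numFieldNormedType.Exports.
Local Open Scope classical_set_scope.
Local Open Scope ring_scope.
Local Open Scope complex_scope.

(* Via Euler's formula: e^(x + iy) = e^x (cos y + i sin y). *)
Definition expC (R : realType) (z : R[i]) : R[i] :=
  (expR (complex.Re z))%:C * (cos (complex.Im z) +i* sin (complex.Im z)).

(* The topology and the scalars are those of R[i] as a normed space over
   itself, so the difference quotient is taken along complex increments. *)
Definition holomorphic (R : realType) (F : R[i] -> R[i]) : Prop :=
  forall z : R[i], derivable (F : R[i]^o -> R[i]^o) z 1.

(* Elements of L_2 are represented by Borel functions (every class of Lebesgue
   measurable functions contains one), to be identified
   when equal almost everywhere. Re `|w| is the modulus of w as a real number. *)
Definition L2 (R : realType) (f : R -> R[i]) : Prop :=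
  [/\ measurable_fun [set: R] (fun u => complex.Re (f u)),
      measurable_fun [set: R] (fun u => complex.Im (f u)) &
      finite_norm (@lebesgue_measure R) 2%:E
        (fun u => complex.Re `|f u|)].

(* The real integral takes a default value when its integrand is not integrable;
   for SB this never happens on L2, since SBkernel z is square-integrable. *)
Definition integralC (R : realType) (f : R -> R[i]) : R[i] :=
  (\int[@lebesgue_measure R]_u complex.Re (f u)) +i*
  (\int[@lebesgue_measure R]_u complex.Im (f u)).

Definition SBkernel (R : realType) (z : R[i]) (u : R) : R[i] :=
  expC (- (u%:C ^+ 2 / 2) + (Num.sqrt 2)%:C * u%:C * z - z ^+ 2 / 2).

Definition SB (R : realType) (f : R -> R[i]) (z : R[i]) : R[i] :=
  integralC (fun u => SBkernel z u * f u).

(* Main.v *)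
(* Holomorphy: for |k| <= 1 the kernel satisfies the second-order estimate
     |A(z+k,u) - A(z,u) - k (sqrt 2 u - z) A(z,u)|
       <= C_z |k|^2 e^(-u^2/2 + c_z |u|),
   and the right-hand side times |f| is integrable for f in L_2, by
   2ab <= a^2 + b^2; integrating it gives the complex derivative.

   Injectivity: at z = i t / sqrt 2 the transform is, up to the factor e^(t^2/4),
   the Fourier transform of h(u) = e^(-u^2/2) f(u), so it is enough that an
   integrable function phi with vanishing Fourier transform is zero almost
   everywhere. The bounded functions psi such that psi times every cosine
   integrates to 0 against phi form a space stable under multiplication by
   cosines and under bounded pointwise limits. It therefore contains
   (1 - x^n)^(n 2^n) for x = (1 - sin(t(u - a))) / 2, hence their limit, the
   indicator of sin(t(u - a)) > 0, and then, letting t tend to 0, the indicator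
   of u > a. So phi has zero primitive, and vanishes almost everywhere by
   Lebesgue differentiation. *)
Require Import Defs.
From mathcomp Require Import all_boot all_order all_algebra.
From mathcomp Require Import all_classical all_reals all_analysis.
From mathcomp Require Import complex measurable_realfun ring lra.
Set Implicit Arguments.
Unset Strict Implicit.
Unset Printing Implicit Defensive.
Import Order.TTheory GRing.Theory Num.Theory.
Import numFieldNormedType.Exports.
Local Open Scope classical_set_scope.
Local Open Scope ring_scope.

(** * Uniqueness for the Fourier transform *)

Section annihilator.
Context {R : realType}.
Notation mu := (@lebesgue_measure R).
Implicit Types (phi psi : R -> R).

Lemma integrableM_cst (k : R) phi : mu.-integrable [set: R] (EFin \o phi) ->
  mu.-integrable [set: R] (EFin \o (fun u => k * phi u)).
Proof. by move=> /(integrableZl measurableT k); exact. Qed.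

Lemma integrable_bounded_mul phi psi (M : R) :
  mu.-integrable [set: R] (EFin \o phi) -> measurable_fun [set: R] psi ->
  (forall u, `|psi u| <= M) ->
  mu.-integrable [set: R] (EFin \o (fun u => psi u * phi u)).
Proof.
move=> iphi mpsi bpsi.
have mphi : measurable_fun [set: R] phi.
  by apply/measurable_EFinP; exact: measurable_int iphi.
have iM : mu.-integrable [set: R] (fun u => M%:E * (EFin \o phi) u)%E.
  by apply: integrableZl.
apply: le_integrable iM => //.
  by apply/measurable_EFinP; exact: measurable_funM.
move=> u _ /=; rewrite lee_fin !normrM ler_wpM2r//.
by rewrite (le_trans (bpsi u))// ler_norm.
Qed.

Lemma measurable_cos_affine (s th : R) :
  measurable_fun [set: R] (fun u => cos (s * u + th)).
Proof.
apply: continuous_measurable_fun => u.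
apply: continuous_comp; last exact: continuous_cos.
by apply: cvgD; [apply: cvgMr; exact: cvg_id|exact: cvg_cst].
Qed.

(* The cosine factor is what makes this class stable under multiplication by
   cosines, through the product-to-sum formula. *)
Definition annihilates phi psi :=
  [/\ measurable_fun [set: R] psi, exists M : R, forall u, `|psi u| <= M &
      forall s th, \int[mu]_u (psi u * cos (s * u + th) * phi u) = 0].

Context (phi : R -> R) (iphi : mu.-integrable [set: R] (EFin \o phi)).

Lemma integrable_annihilates psi s th : annihilates phi psi ->
  mu.-integrable [set: R] (EFin \o (fun u => psi u * cos (s * u + th) * phi u)).
Proof.
case=> mpsi [M bM] _; apply: (@integrable_bounded_mul _ _ M) => //.
  by apply: measurable_funM => //; exact: measurable_cos_affine.
move=> u; rewrite normrM (le_trans _ (bM u))// ler_piMr// .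
by rewrite ler_norml cos_geN1 cos_le1.
Qed.

Lemma annihilatesD psi1 psi2 : annihilates phi psi1 -> annihilates phi psi2 ->
  annihilates phi (fun u => psi1 u + psi2 u).
Proof.
move=> A1 A2; split.
- by case: A1 A2 => ? _ _ [? _ _]; exact: measurable_funD.
- case: A1 A2 => _ [M1 b1] _ [_ [M2 b2] _]; exists (M1 + M2) => u.
  by rewrite (le_trans (ler_normD _ _))// lerD.
- move=> s th; under eq_Rintegral do rewrite !mulrDl.
  rewrite RintegralD//; [|exact: integrable_annihilates..].
  by case: A1 A2 => _ _ -> [_ _ ->]; rewrite addr0.
Qed.

Lemma annihilatesZ k psi : annihilates phi psi ->
  annihilates phi (fun u => k * psi u).
Proof.
move=> A; split.
- by case: A => ? _ _; exact: measurable_funM.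
- by case: A => _ [M b] _; exists (`|k| * M) => u; rewrite normrM ler_wpM2l.
- move=> s th; under eq_Rintegral do rewrite -!mulrA [psi _ * _]mulrA.
  rewrite RintegralZl//; last exact: integrable_annihilates.
  by case: A => _ _ ->; rewrite mulr0.
Qed.

Lemma annihilatesB psi1 psi2 : annihilates phi psi1 -> annihilates phi psi2 ->
  annihilates phi (fun u => psi1 u - psi2 u).
Proof.
move=> A1 A2; have -> : (fun u => psi1 u - psi2 u) =
    (fun u => psi1 u + (-1) * psi2 u) by apply/funext => u; rewrite mulN1r.
by apply: annihilatesD => //; exact: annihilatesZ.
Qed.

Lemma annihilates_cos t a psi : annihilates phi psi ->
  annihilates phi (fun u => cos (t * u + a) * psi u).
Proof.
move=> A; split.
- case: A => ? _ _; apply: measurable_funM => //; exact: measurable_cos_affine.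
- case: A => _ [M b] _; exists M => u.
  rewrite normrM (le_trans _ (b u))// ler_piMl//.
  by rewrite ler_norml cos_geN1 cos_le1.
- move=> s th.
  have E u : cos (t * u + a) * psi u * cos (s * u + th) * phi u =
     2^-1 * (psi u * cos ((t + s) * u + (a + th)) * phi u) +
     2^-1 * (psi u * cos ((t - s) * u + (a - th)) * phi u).
    have -> : (t + s) * u + (a + th) = (t * u + a) + (s * u + th) by ring.
    have -> : (t - s) * u + (a - th) = (t * u + a) - (s * u + th) by ring.
    by rewrite (cosD (t * u + a)) (cosB (t * u + a)); field.
  under eq_Rintegral do rewrite E.
  rewrite RintegralD//; last 2 first.
  + by apply: integrableM_cst; exact: integrable_annihilates.
  + by apply: integrableM_cst; exact: integrable_annihilates.
  rewrite !RintegralZl//; [|exact: integrable_annihilates..].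
  by case: A => _ _ A; rewrite !A !mulr0 addr0.
Qed.

(** Dominated convergence with dominating function [M * |phi|], the cosine being at most 1 in
    modulus. The uniform bound [M] also passes to the limit. *)
Lemma annihilates_lim (psi_ : nat -> R -> R) psi (M : R) :
  (forall n, annihilates phi (psi_ n)) ->
  (forall n u, `|psi_ n u| <= M) ->
  (forall u, psi_ n u @[n --> \oo] --> psi u) ->
  annihilates phi psi.
Proof.
move=> A b c.
have mpsi : measurable_fun [set: R] psi.
  apply: measurable_realfun.measurable_fun_cvg => [n|u _]; last exact: c.
  by case: (A n).
have bpsi u : `|psi u| <= M.
  by apply: (cvgr_to_le (cvg_norm (c u))); exact: nearW.
split=> //; first by exists M.
move=> s th.
have mphi : measurable_fun [set: R] phi.
  by apply/measurable_EFinP; exact: measurable_int iphi.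
pose F n u := psi_ n u * cos (s * u + th) * phi u.
have [] := @dominated_convergence _ _ _ mu _ measurableT
  (fun n => EFin \o F n) (EFin \o (fun u => psi u * cos (s * u + th) * phi u))
  (fun u => M%:E * (abse \o (EFin \o phi)) u)%E.
- by move=> n; have /(integrable_annihilates s th)/measurable_int := A n.
- apply/measurable_EFinP; apply: measurable_funM => //.
  by apply: measurable_funM => //; exact: measurable_cos_affine.
- apply: aeW => u _; apply: cvg_EFin; first exact: nearW.
  rewrite /comp/=; apply: cvgMl; apply: cvgMl; exact: c.
- by apply: integrableZl => //; exact: integrable_abse.
- apply: aeW => u n _ /=; rewrite lee_fin /F -mulrA normrM.
  rewrite ler_pM// normrM ler_piMl//.
  by rewrite ler_norml cos_geN1 cos_le1.
move=> _ _.
have -> : [sequence (\int[mu]_x (EFin \o F n) x)%E]_n = (fun=> 0%E).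
  apply/funext => n /=.
  have i := integrable_annihilates s th (A n).
  (* [Rintegral] is the [fine] part of the extended integral. Integrability makes the latter finite,
     so it is itself 0. *)
  rewrite -[LHS]fineK; last by apply: integrable_fin_num.
  by case: (A n) => _ _ An; have := An s th; rewrite /Rintegral => ->.
move=> /cvg_lim-/(_ (@ereal_hausdorff _)).
by move=> E; rewrite /Rintegral -E lim_cst.
Qed.

End annihilator.

(** * Polynomial approximation of a step function on [0, 1] *)

Section step.
Context {R : realType}.
Implicit Types x y : R.

Lemma bernoulliD y n : 0 <= y -> 1 + n%:R * y <= (1 + y) ^+ n.
Proof.
move=> y0; elim: n => [|n IHn]; first by rewrite mul0r addr0.
rewrite exprS (le_trans _ (ler_wpM2l _ IHn))//; last by rewrite addr_ge0.
have n0 : 0 <= n%:R * y ^+ 2 :> R by rewrite mulr_ge0// sqr_ge0.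
by rewrite -natr1; nra.
Qed.

Lemma bernoulliB y n : 0 <= y <= 1 -> 1 - n%:R * y <= (1 - y) ^+ n.
Proof.
move=> /andP[y0 y1]; elim: n => [|n IHn]; first by rewrite mul0r subr0.
rewrite exprS (le_trans _ (ler_wpM2l _ IHn))//; last by rewrite subr_ge0.
have n0 : 0 <= n%:R * y ^+ 2 :> R by rewrite mulr_ge0// sqr_ge0.
by rewrite -natr1; nra.
Qed.

(** Write [y = z * z] with [z < 1]. Bernoulli's inequality for [z^-1 = 1 + (z^-1 - 1)] bounds
    [n * z ^+ n] by [(1 - z)^-1], and the remaining factor [z ^+ n] tends to 0. *)
Lemma cvg_natr_mul_expr y : 0 <= y < 1 -> n%:R * y ^+ n @[n --> \oo] --> (0 : R).
Proof.
move=> /andP[y0 y1].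
pose z := Num.sqrt y; have z0 : 0 <= z := sqrtr_ge0 _.
have yz : y = z * z by rewrite -expr2 sqr_sqrtr.
have z1 : z < 1.
  rewrite ltNge; apply/negP => z1; move: y1; rewrite yz ltNge => /negP; apply.
  nra.
have bnd n : n%:R * z ^+ n <= (1 - z)^-1.
  have [->|zn0] := eqVneq z 0.
    case: n => [|n]; first by rewrite mul0r invr_ge0 subr_ge0.
    by rewrite exprS mul0r mulr0 subr0 invr1.
  have zp : 0 < z by rewrite lt_def zn0.
  have := @bernoulliD (z^-1 - 1) n; rewrite subr_ge0 invf_ge1// ltW// => /(_ isT).
  have -> : 1 + (z^-1 - 1) = z^-1 by ring.
  rewrite exprVn => H.
  have zn : 0 < z ^+ n by rewrite exprn_gt0.
  have : n%:R * (z^-1 - 1) <= (z ^+ n)^-1 by lra.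
  rewrite -(ler_pM2r zn) mulVf ?gt_eqF// => H2.
  rewrite -[leRHS]mul1r ler_pdivlMr ?subr_gt0//.
  apply: le_trans _ (le_trans H2 _); last by [].
  have -> : n%:R * z ^+ n * (1 - z) = n%:R * (z^-1 - 1) * z ^+ n * z.
    by field; rewrite gt_eqF.
  apply: ler_piMr; last exact: ltW.
  by rewrite !mulr_ge0// ?subr_ge0 ?invf_ge1// ltW.
apply: (@squeeze_cvgr _ _ _ _ (fun=> 0) (fun n => (1 - z)^-1 * z ^+ n)).
- apply: nearW => n; rewrite mulr_ge0 ?exprn_ge0//=.
  by rewrite yz exprMn mulrA ler_wpM2r ?exprn_ge0.
- exact: cvg_cst.
- rewrite -[X in _ --> X](mulr0 (1 - z)^-1); apply: cvgMr.
  by apply: cvg_expr; rewrite ger0_norm.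
Qed.

(* The factor n in the exponent makes the limit at x = 1/2 equal to 0. *)
Definition pstep n x := (1 - x ^+ n) ^+ (n * 2 ^ n).

Lemma pstep_itv n x : 0 <= x <= 1 -> 0 <= pstep n x <= 1.
Proof.
move=> /andP[x0 x1].
have y0 : 0 <= x ^+ n by rewrite exprn_ge0.
have y1 : x ^+ n <= 1 by rewrite exprn_ile1.
by apply/andP; split; [apply: exprn_ge0; lra|apply: exprn_ile1; lra].
Qed.

(** With [N = n * 2 ^ n] one has [N x^n = n (2x)^n]. For [x < 1/2] this tends to 0, and Bernoulli
    gives [pstep n x >= 1 - n (2x)^n]. For [x >= 1/2] it is at least [n]; since
    [(1 - x^n) (1 + x^n) <= 1], [pstep n x] is at most the inverse of [(1 + x^n)^N], hence at most
    [1 / (n + 1)]. *)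
Lemma cvg_pstep x : 0 <= x <= 1 ->
  pstep n x @[n --> \oo] --> ((x < 2^-1)%R%:R : R).
Proof.
move=> x01; have /andP[x0 x1] := x01.
have NE n : (n * 2 ^ n)%:R * x ^+ n = n%:R * (2 * x) ^+ n.
  by rewrite natrM natrX exprMn mulrA.
have [xh|xh] := ltP x 2^-1 => /=.
- apply: (@squeeze_cvgr _ _ _ _ (fun n => 1 - n%:R * (2 * x) ^+ n) (fun=> 1)).
  + apply: nearW => n; have /andP[_ ->] := pstep_itv n x01; rewrite andbT.
    by rewrite -NE bernoulliB// exprn_ge0// exprn_ile1.
  + rewrite -[X in _ --> X]subr0; apply: cvgB; first exact: cvg_cst.
    by apply: cvg_natr_mul_expr; apply/andP; split; lra.
  + exact: cvg_cst.
- apply: (@squeeze_cvgr _ _ _ _ (fun=> 0) (@harmonic R)).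
  + apply: nearW => n; have /andP[-> _] /= := pstep_itv n x01.
    have y0 : 0 <= x ^+ n by rewrite exprn_ge0.
    have y1 : x ^+ n <= 1 by rewrite exprn_ile1.
    have h1 : pstep n x * (1 + x ^+ n) ^+ (n * 2 ^ n) <= 1.
      rewrite /pstep -exprMn exprn_ile1//; nra.
    have h2 : n.+1%:R <= (1 + x ^+ n) ^+ (n * 2 ^ n).
      apply: le_trans (bernoulliD _ y0); rewrite NE -natr1 addrC lerD2l.
      rewrite ler_peMr// exprn_ege1//; lra.
    rewrite /harmonic/= -[leRHS]mul1r ler_pdivlMr//.
    apply: le_trans h1; apply: ler_wpM2l => //.
    by have /andP[] := pstep_itv n x01.
  + exact: cvg_cst.
  + exact: cvg_harmonic.
Qed.

End step.

(** * From vanishing cosine integrals to half-lines and uniqueness *)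

Section annihilates_step.
Context {R : realType}.
Notation mu := (@lebesgue_measure R).
Context (phi : R -> R) (iphi : mu.-integrable [set: R] (EFin \o phi)).
Hypothesis cos_phi0 : forall s th, \int[mu]_u (cos (s * u + th) * phi u) = 0.
(** Carries the range [-1, 1] of the cosine to [0, 1], so that a positive cosine corresponds to
    [x < 1/2], the threshold of [pstep]. *)
Local Notation x_ t a := (fun u : R => (1 - cos (t * u + a)) / 2).

Lemma annihilates1 : annihilates phi (fun=> 1).
Proof.
split=> //; first by exists 1 => u; rewrite normr1.
by move=> s th; under eq_Rintegral do rewrite mul1r.
Qed.

(** [pstep n] is a polynomial, and multiplication by [(1 - cos) / 2] preserves the class, so
    multiplication by powers of it does too. *)
Lemma annihilates_pstep t a n : annihilates phi (fun u => pstep n (x_ t a u)).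
Proof.
have A1 psi : annihilates phi psi -> annihilates phi (fun u => x_ t a u * psi u).
  move=> A; have -> : (fun u => x_ t a u * psi u) =
      (fun u => 2^-1 * psi u - 2^-1 * (cos (t * u + a) * psi u)).
    by apply/funext => u; field.
  apply: annihilatesB => //; apply: annihilatesZ => //.
  exact: annihilates_cos.
have An k psi : annihilates phi psi ->
    annihilates phi (fun u => x_ t a u ^+ k * psi u).
  move=> A; elim: k => [|k IHk].
    by under eq_fun do rewrite expr0 mul1r.
  by under eq_fun do rewrite exprS -mulrA; exact: A1.
(* Only the outer exponent is generalised; with [y] the inner power,
   [(1 - y)^(k+1) = (1 - y)^k - y (1 - y)^k]. *)
rewrite /pstep; elim: (n * 2 ^ n)%N => [|k IHk].
  by under eq_fun do rewrite expr0; exact: annihilates1.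
under eq_fun do rewrite exprS mulrBl mul1r.
by apply: annihilatesB => //; exact: An.
Qed.

Lemma annihilates_cos_gt0 t a :
  annihilates phi (fun u => (0 < cos (t * u + a))%R%:R).
Proof.
have x01 u : 0 <= x_ t a u <= 1.
  have := cos_geN1 (t * u + a); have := cos_le1 (t * u + a).
  by move=> c1 c2; apply/andP; split; lra.
apply: (@annihilates_lim _ _ iphi (fun n u => pstep n (x_ t a u)) _ 1) => //.
- by move=> n; exact: annihilates_pstep.
- by move=> n u; have /andP[p0 p1] := pstep_itv n (x01 u); rewrite ger0_norm.
- move=> u; have -> : (0 < cos (t * u + a)) = (x_ t a u < 2^-1).
    by apply/idP/idP => ?; lra.
  exact: cvg_pstep.
Qed.

(** The phase turns the cosine into [sin ((u - a) / (n + 1))]. Once the angle lies strictly between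
    [- pi] and [pi], the sine has the sign of [u - a], so at each [u] the sequence is eventually
    constant. *)
Lemma annihilates_gt a : annihilates phi (fun u => (a < u)%R%:R).
Proof.
apply: (@annihilates_lim _ _ iphi
  (fun n u =>
     (0 < cos (n.+1%:R^-1 * u + (- (n.+1%:R^-1 * a) - pi / 2)))%R%:R) _ 1).
- by move=> n; exact: annihilates_cos_gt0.
- by move=> n u; case: (0 < _); rewrite ?normr1 ?normr0.
move=> u.
have cE n : cos (n.+1%:R^-1 * u + (- (n.+1%:R^-1 * a) - pi / 2)) =
    sin ((u - a) / n.+1%:R).
  rewrite -[LHS]cosN -[RHS]cosBpihalf -cosN; congr cos; ring.
have small : \forall n \near \oo, `|(u - a) / n.+1%:R| < pi :> R.
  have : (u - a) * harmonic n @[n --> \oo] --> (0 : R).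
    by rewrite -[X in _ --> X](mulr0 (u - a)); apply: cvgMr; exact: cvg_harmonic.
  by move=> /cvgr0Pnorm_lt; apply; exact: pi_gt0.
apply: cvg_near_cst; near=> n; rewrite cE.
have n0 : 0 < n.+1%:R^-1 :> R by rewrite invr_gt0.
have np : `|(u - a) / n.+1%:R| < pi by near: n.
have [au|ua] := ltP a u.
  have y0 : 0 < (u - a) / n.+1%:R by rewrite mulr_gt0 ?subr_gt0.
  by rewrite sin_gt0_pi// y0 -(ger0_norm (ltW y0)).
have y0 : (u - a) / n.+1%:R <= 0 by rewrite pmulr_lle0 ?subr_le0.
rewrite ltNge -oppr_ge0 -sinN sin_ge0_pi// oppr_ge0 y0/=.
by rewrite -(ler0_norm y0) ltW.
Unshelve. all: by end_near. Qed.

Lemma cos_transform_eq0 : phi = cst 0 %[ae mu].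
Proof.
have loc : locally_integrable [set: R] phi.
  exact: open_integrable_locally openT iphi.
have iS y : mu.-integrable `]-oo, y] (EFin \o phi).
  by apply: integrableS iphi.
have F0 (y : R) : \int[mu]_(u in `]-oo, y]) phi u = 0.
  rewrite Rintegral_mkcond.
  (* The half-line is the complement of [u > y]; the factor [cos (0 * u + 0) = 1] matches the form
     of the integrals in [annihilates]. *)
  have -> : phi \_ `]-oo, y] =
      fun u => (1 - (y < u)%R%:R) * cos (0 * u + 0) * phi u.
    apply/funext => u; rewrite mul0r addr0 cos0 mulr1 patchE mem_setE in_itv/=.
    by case: ltP; rewrite ?subrr ?mul0r ?subr0 ?mul1r.
  by have [_ _] := annihilatesB iphi annihilates1 (annihilates_gt y); exact.
have := FTC1Ny iS loc.
have -> : (fun x : R => \int[mu]_(t in `]-oo, x]) phi t) = cst 0.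
  by apply/funext => y; exact: F0.
apply: filterS; first exact: (ae_filter_ringOfSetsType mu).
by move=> u /= [_ <-] _; rewrite derive1_cst.
Qed.

End annihilates_step.

(** * The complex exponential *)

Section real_estimates.
Context {R : realType}.
Implicit Types a b x y u c : R.

Lemma le_normr_sin x : `|sin x| <= `|x|.
Proof.
wlog x0 : x / 0 <= x => [H|].
  have [/H//|x0] := leP 0 x.
  by rewrite -normrN -sinN -[leRHS]normrN; apply: H; rewrite oppr_ge0 ltW.
have [|y _] := @MVT_segment R sin cos 0 x x0 (fun y _ => is_derive_sin y).
  by apply: continuous_subspaceT => y; exact: continuous_sin.
rewrite sin0 !subr0 => ->; rewrite normrM ler_piMl//.
by rewrite ler_norml cos_geN1 cos_le1.
Qed.

Lemma cos_half_angle x : cos x = 1 - 2 * sin (x / 2) ^+ 2.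
Proof.
have {1}-> : x = (x / 2) *+ 2 by rewrite mulr2n; field.
by rewrite cos_mulr2n; have := cos2Dsin2 (x / 2); lra.
Qed.

Lemma subr1_cos_itv x : 0 <= 1 - cos x <= x ^+ 2.
Proof.
rewrite subr_ge0 cos_le1/= cos_half_angle.
have : sin (x / 2) ^+ 2 <= (x / 2) ^+ 2.
  rewrite -[leLHS]real_normK ?num_real// -[leRHS]real_normK ?num_real//.
  by rewrite lerXn2r ?nnegrE// le_normr_sin.
have := sqr_ge0 x; nra.
Qed.

Lemma subr1_cos_le x : 1 - cos x <= `|x|.
Proof.
rewrite cos_half_angle.
have := le_normr_sin (x / 2); rewrite normrM normfV [`|2|]ger0_norm//.
have := sin_max (x / 2); rewrite -(real_normK (num_real (sin (x / 2)))).
have := normr_ge0 (sin (x / 2)); nra.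
Qed.

(** Mean value theorem: the derivative [cos y - 1] has modulus at most [|y|] by [subr1_cos_le]. *)
Lemma le_normr_sinB x : `|sin x - x| <= x ^+ 2.
Proof.
wlog x0 : x / 0 <= x => [H|].
  have [/H//|x0] := leP 0 x.
  have -> : sin x - x = - (sin (- x) - - x) by rewrite sinN; ring.
  by rewrite normrN -sqrrN; apply: H; rewrite oppr_ge0 ltW.
have D y : is_derive y 1 (sin - id : R -> R) (cos y - 1) by apply: is_deriveB.
have [|y] := @MVT_segment R _ (fun y => cos y - 1) 0 x x0 (fun y _ => D y).
  apply: continuous_subspaceT => y.
  by apply: cvgB; [exact: continuous_sin|exact: cvg_id].
rewrite in_itv/= => /andP[y0 yx].
rewrite !fctE sin0 !subr0 => ->; rewrite normrM (ger0_norm x0) expr2 ler_wpM2r//.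
rewrite distrC ger0_norm ?subr_ge0 ?cos_le1//.
by rewrite (le_trans (subr1_cos_le _))// ger0_norm.
Qed.

(** Everything comes from [1 + x <= expR x], used at [a] and at [- a]; for [a >= 0] the latter, read
    as [(1 - a) * expR a <= 1], gives [expR a - 1 <= a * expR a]. *)
Lemma le_normr_expR_sub1 a : `|expR a - 1| <= `|a| * expR `|a|.
Proof.
have e1 := expR_ge1Dx a.
have [a0|a0] := leP 0 a.
  rewrite (ger0_norm a0) ger0_norm; last lra.
  have := expR_ge1Dx (- a); rewrite expRN.
  have e0 := expR_gt0 a => H.
  have : (1 - a) * expR a <= 1 by rewrite -ler_pdivlMr// div1r.
  lra.
have e2 : expR a <= 1 by rewrite -expR0 ler_expR ltW.
rewrite (ltr0_norm a0) ler0_norm; last lra.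
have : 1 <= expR (- a) by rewrite -expR0 ler_expR oppr_ge0 ltW.
nra.
Qed.

Lemma le_normr_expR_sub1D a : `|expR a - 1 - a| <= a ^+ 2 * expR `|a|.
Proof.
have e1 := expR_ge1Dx a.
rewrite ger0_norm; last lra.
(* This is [(1 - a) * expR a <= 1] rearranged, valid for either sign of [a]. *)
have e2 : expR a - 1 - a <= a * (expR a - 1).
  have := expR_ge1Dx (- a); rewrite expRN => H.
  have : (1 - a) * expR a <= 1 by rewrite -ler_pdivlMr ?expR_gt0// div1r.
  lra.
rewrite (le_trans e2)// (le_trans (ler_norm _))// normrM.
rewrite -(real_normK (num_real a)) expr2 -mulrA ler_wpM2l//.
exact: le_normr_expR_sub1.
Qed.

End real_estimates.

(** * Modulus and second-order remainder of the complex exponential *)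

Section complex_estimates.
Context {R : realType}.
Local Open Scope complex_scope.
Import Normc.
Implicit Types (z w : R[i]).

Lemma normc_ge0 z : 0 <= normc z. Proof. by case: z => a b; exact: sqrtr_ge0. Qed.

Lemma normCE z : `|z| = (normc z)%:C. Proof. by []. Qed.

Lemma normcB z w : normc (z - w) <= normc z + normc w.
Proof. by rewrite -(normcN w); exact: le_normcD. Qed.

Lemma normc_real (x : R) : normc x%:C = `|x|.
Proof. by rewrite /= expr0n/= addr0 sqrtr_sqr. Qed.

Lemma normr_Re_le z : `|complex.Re z| <= normc z.
Proof. by case: z => a b /=; rewrite -sqrtr_sqr ler_wsqrtr// lerDl sqr_ge0. Qed.

Lemma normr_Im_le z : `|complex.Im z| <= normc z.
Proof. by case: z => a b /=; rewrite -sqrtr_sqr ler_wsqrtr// lerDr sqr_ge0. Qed.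

Lemma normc_le_ReIm z : normc z <= `|complex.Re z| + `|complex.Im z|.
Proof.
case: z => a b /=; rewrite -[leRHS]ger0_norm ?addr_ge0// -sqrtr_sqr ler_wsqrtr//.
rewrite sqrrD !real_normK ?num_real//.
have : 0 <= `|a| * `|b| by rewrite mulr_ge0.
rewrite mulr2n; lra.
Qed.

Lemma expCD z w : expC (z + w) = expC z * expC w.
Proof.
case: z => a b; case: w => c d; rewrite /expC /=.
rewrite expRD cosD sinD; simpc; congr (_ +i* _); ring.
Qed.

Lemma normc_expC z : normc (expC z) = expR (complex.Re z).
Proof.
rewrite /expC normcM normc_real ger0_norm ?expR_ge0//= cos2Dsin2 sqrtr1 mulr1 //.
Qed.

(** For [w = a + ib] and [r = |w|], the real part of the remainder is
    [e^a (cos b - 1) + (e^a - 1 - a)] and the imaginary part is [e^a (sin b - b) + (e^a - 1) b].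
    Each of the four terms is at most [r^2 e^r], whence the constant 4. *)
Lemma normc_expC_taylor w :
  normc (expC w - 1 - w) <= 4 * normc w ^+ 2 * expR (normc w).
Proof.
have Re_le := normr_Re_le w; have Im_le := normr_Im_le w.
have r0 := normc_ge0 w.
apply: (le_trans (normc_le_ReIm _)).
move: (normc w) Re_le Im_le r0 => r; rewrite /expC.
case: w => a b /= Re_le Im_le r0; simpc => /=.
have ea : expR `|a| <= expR r by rewrite ler_expR.
have ea' : expR a <= expR r by rewrite ler_expR (le_trans (ler_norm _)).
have E1 := le_normr_expR_sub1 a.
have E2 := le_normr_expR_sub1D a.
have C1 : `|cos b - 1| <= b ^+ 2.
  by rewrite distrC; have /andP[c0 c1] := subr1_cos_itv b; rewrite ger0_norm.
have S1 := le_normr_sinB b.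
have a2 : a ^+ 2 <= r ^+ 2 by rewrite -real_normK ?num_real// lerXn2r ?nnegrE.
have b2 : b ^+ 2 <= r ^+ 2 by rewrite -real_normK ?num_real// lerXn2r ?nnegrE.
have r2 := sqr_ge0 r; have er := expR_ge0 r.
have P1 : `|expR a * (cos b - 1)| <= r ^+ 2 * expR r.
  rewrite normrM (ger0_norm (expR_ge0 a)) mulrC ler_pM ?expR_ge0//.
  exact: le_trans C1 b2.
have P2 : `|expR a - 1 - a| <= r ^+ 2 * expR r.
  by rewrite (le_trans E2)// ler_pM ?sqr_ge0 ?expR_ge0.
have P3 : `|expR a * (sin b - b)| <= r ^+ 2 * expR r.
  rewrite normrM (ger0_norm (expR_ge0 a)) mulrC ler_pM ?expR_ge0//.
  exact: le_trans S1 b2.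
have P4 : `|(expR a - 1) * b| <= r ^+ 2 * expR r.
  rewrite normrM (le_trans (ler_wpM2r _ E1))//.
  by rewrite -mulrA mulrCA mulrC expr2 ler_pM ?mulr_ge0 ?expR_ge0// ler_pM.
have -> : expR a * cos b - 1 - a = expR a * (cos b - 1) + (expR a - 1 - a) by ring.
have -> : expR a * sin b - b = expR a * (sin b - b) + (expR a - 1) * b by ring.
have := ler_normD (expR a * (cos b - 1)) (expR a - 1 - a).
have := ler_normD (expR a * (sin b - b)) ((expR a - 1) * b).
lra.
Qed.

End complex_estimates.

(** * Complex-valued integrals *)

Section complex_integral.
Context {R : realType}.
Local Open Scope complex_scope.
Import Normc.
Notation mu := (@lebesgue_measure R).
Implicit Types (F G : R -> R[i]) (z w k : R[i]).

Definition measurableC F :=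
  measurable_fun [set: R] (fun u => complex.Re (F u)) /\
  measurable_fun [set: R] (fun u => complex.Im (F u)).

Definition integrableC F :=
  mu.-integrable [set: R] (EFin \o (fun u => complex.Re (F u))) /\
  mu.-integrable [set: R] (EFin \o (fun u => complex.Im (F u))).

Lemma measurableC_real (h : R -> R) : measurable_fun [set: R] h ->
  measurableC (fun u => (h u)%:C).
Proof. by move=> mh; split => //=; exact: measurable_cst. Qed.

Lemma measurableC_cst k : measurableC (fun=> k).
Proof. by split; exact: measurable_cst. Qed.

Lemma ReD z w : complex.Re (z + w) = complex.Re z + complex.Re w.
Proof. by case: z => ? ?; case: w. Qed.
Lemma ImD z w : complex.Im (z + w) = complex.Im z + complex.Im w.
Proof. by case: z => ? ?; case: w. Qed.
Lemma ReM z w : complex.Re (z * w) =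
  complex.Re z * complex.Re w - complex.Im z * complex.Im w.
Proof. by case: z => ? ?; case: w. Qed.
Lemma ImM z w : complex.Im (z * w) =
  complex.Re z * complex.Im w + complex.Im z * complex.Re w.
Proof. by case: z => ? ?; case: w. Qed.

Lemma measurableCD F G : measurableC F -> measurableC G ->
  measurableC (fun u => F u + G u).
Proof.
move=> [F1 F2] [G1 G2]; split.
- by under eq_fun do rewrite ReD; exact: measurable_funD.
- by under eq_fun do rewrite ImD; exact: measurable_funD.
Qed.

Lemma measurableCM F G : measurableC F -> measurableC G ->
  measurableC (fun u => F u * G u).
Proof.
move=> [F1 F2] [G1 G2]; split.
- by under eq_fun do rewrite ReM; apply: measurable_funB; exact: measurable_funM.
- by under eq_fun do rewrite ImM; apply: measurable_funD; exact: measurable_funM.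
Qed.

Lemma measurableCN F : measurableC F -> measurableC (fun u => - F u).
Proof.
move=> mF; under eq_fun do rewrite -mulN1r.
by apply: measurableCM => //; exact: measurableC_cst.
Qed.

Lemma measurableC_expC F : measurableC F -> measurableC (fun u => expC (F u)).
Proof.
move=> [F1 F2]; apply: measurableCM.
  by apply: measurableC_real; apply: measurableT_comp.
split => /=.
  apply: measurableT_comp => //.
  by apply: continuous_measurable_fun; exact: continuous_cos.
apply: measurableT_comp => //.
by apply: continuous_measurable_fun; exact: continuous_sin.
Qed.

Lemma measurable_normc F : measurableC F ->
  measurable_fun [set: R] (fun u => normc (F u)).
Proof.
move=> [F1 F2].
have E u : normc (F u) = Num.sqrt (complex.Re (F u) ^+ 2 + complex.Im (F u) ^+ 2).
  by case: (F u).
under eq_fun do rewrite E.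
apply: (measurableT_comp (f := @Num.sqrt R)).
  by apply: continuous_measurable_fun; exact: sqrt_continuous.
by apply: measurable_funD; exact: measurable_funX.
Qed.

Lemma integrableCD F G : integrableC F -> integrableC G ->
  integrableC (fun u => F u + G u).
Proof.
move=> [F1 F2] [G1 G2]; split.
- by under eq_fun do rewrite ReD; have := integrableD measurableT F1 G1.
- by under eq_fun do rewrite ImD; have := integrableD measurableT F2 G2.
Qed.

Lemma integrableCZ k F : integrableC F -> integrableC (fun u => k * F u).
Proof.
have H (a b : R) (f g : R -> R) : mu.-integrable [set: R] (EFin \o f) ->
    mu.-integrable [set: R] (EFin \o g) ->
    mu.-integrable [set: R] (EFin \o (fun u => a * f u + b * g u)).
  move=> /(integrableM_cst a) fi /(integrableM_cst b) gi.
  exact: (integrableD measurableT fi gi).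
move=> [F1 F2]; split.
- by under eq_fun do rewrite ReM -mulNr; exact: H.
- by under eq_fun do rewrite ImM; exact: H.
Qed.

Lemma integralCD F G : integrableC F -> integrableC G ->
  integralC (fun u => F u + G u) = integralC F + integralC G.
Proof.
move=> [F1 F2] [G1 G2]; rewrite /integralC; simpc; congr (_ +i* _).
- by under eq_Rintegral do rewrite ReD; rewrite RintegralD.
- by under eq_Rintegral do rewrite ImD; rewrite RintegralD.
Qed.

Lemma integralCZ k F : integrableC F ->
  integralC (fun u => k * F u) = k * integralC F.
Proof.
have H (a b : R) (f g : R -> R) : mu.-integrable [set: R] (EFin \o f) ->
    mu.-integrable [set: R] (EFin \o g) ->
    \int[mu]_u (a * f u + b * g u) = a * \int[mu]_u f u + b * \int[mu]_u g u.
  move=> fi gi; rewrite RintegralD ?RintegralZl//; exact: integrableM_cst.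
move=> [F1 F2]; rewrite /integralC; case: k => a b; simpc; congr (_ +i* _).
- by under eq_Rintegral do rewrite ReM -mulNr; rewrite H//= mulNr.
- by under eq_Rintegral do rewrite ImM; rewrite H.
Qed.

Lemma integrableC_le F (g : R -> R) : measurableC F ->
  mu.-integrable [set: R] (EFin \o g) -> (forall u, normc (F u) <= g u) ->
  integrableC F.
Proof.
move=> [F1 F2] ig Fg; split.
- apply: le_integrable ig => //; first exact/measurable_EFinP.
  move=> u _ /=; rewrite lee_fin (le_trans (normr_Re_le _))//.
  by rewrite (le_trans (Fg u))// ler_norm.
- apply: le_integrable ig => //; first exact/measurable_EFinP.
  move=> u _ /=; rewrite lee_fin (le_trans (normr_Im_le _))//.
  by rewrite (le_trans (Fg u))// ler_norm.
Qed.

(** The factor 2 comes from bounding the real and imaginary parts separately. *)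
Lemma normc_integralC_le F (g : R -> R) : measurableC F ->
  mu.-integrable [set: R] (EFin \o g) -> (forall u, normc (F u) <= g u) ->
  normc (integralC F) <= 2 * \int[mu]_u g u.
Proof.
move=> mF ig Fg; have [F1 F2] := integrableC_le mF ig Fg.
have H (h : R -> R) : mu.-integrable [set: R] (EFin \o h) ->
    (forall u, `|h u| <= g u) -> `|\int[mu]_u h u| <= \int[mu]_u g u.
  move=> ih hg; apply: (le_trans (le_normr_Rintegral measurableT ih)).
  apply: le_Rintegral => //; exact: integrable_norm.
apply: (le_trans (normc_le_ReIm _)); rewrite mulr2n mulrDl mul1r.
apply: lerD; apply: H => // u; apply: le_trans (Fg u).
- exact: normr_Re_le.
- exact: normr_Im_le.
Qed.

End complex_integral.

(** * Gaussian weights against square-integrable functions *)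

Section L2_gaussian.
Context {R : realType}.
Local Open Scope complex_scope.
Import Normc.
Notation mu := (@lebesgue_measure R).

Lemma L2_measurable (f : R -> R[i]) : L2 f -> measurableC f.
Proof. by case. Qed.

Lemma L2_integrable_sqr (f : R -> R[i]) : L2 f ->
  mu.-integrable [set: R] (EFin \o (fun u => normc (f u) ^+ 2)).
Proof.
move=> Lf; have mf := measurable_normc (L2_measurable Lf).
case: Lf => _ _; rewrite /finite_norm => fin; apply/integrableP; split.
  by apply/measurable_EFinP; exact: measurable_funX.
have -> : (fun u => `|(EFin \o (fun u => normc (f u) ^+ 2)%R) u|)%E =
    (fun u => `|(EFin \o (fun u => normc (f u))) u| `^ 2)%E.
  by apply/funext => u /=; rewrite powR_mulrn// normrX.
(* The integral is the square of the L_2 norm, which is finite. *)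
by rewrite -poweR_Lnorm// poweR_lty.
Qed.

(** The common dominating weight for the kernel and its increments, the linear term absorbing the
    dependence on [z]. At [c = 0] it is the Gaussian factor of the Fourier reduction. *)
Definition gaussw (c : R) (u : R) := expR (- (u ^+ 2 / 2) + c * `|u|).

Lemma measurable_gaussw c : measurable_fun [set: R] (gaussw c).
Proof.
apply: continuous_measurable_fun => u.
apply: continuous_comp; last exact: continuous_expR.
apply: cvgD; last by apply: cvgMr; exact: cvg_norm.
by apply: cvgN; apply: cvgMl; exact: exprn_continuous.
Qed.

(** From [(|u| - 2c)^2 >= 0] follows [- u^2 + 2c|u| <= - u^2 / 2 + 2c^2], so the square is dominated
    by a multiple of the standard normal density. *)
Lemma integrable_gaussw_sqr c :
  mu.-integrable [set: R] (EFin \o (fun u => gaussw c u ^+ 2)).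
Proof.
have n0 : normal_peak (1 : R) != 0 by rewrite gt_eqF// normal_peak_gt0// oner_eq0.
have := integrable_normal_pdf (0 : R) 1.
move=> /(integrableM_cst ((normal_peak (1 : R))^-1 * expR (2 * c ^+ 2))) => H.
apply: le_integrable H => //.
  by apply/measurable_EFinP; apply: measurable_funX; exact: measurable_gaussw.
move=> u _; rewrite lee_fin ger0_norm ?sqr_ge0//.
have -> : normal_pdf 0 1 u = normal_peak 1 * normal_fun 0 1 u :> R.
  by rewrite /normal_pdf oner_eq0.
rewrite ger0_norm; last first.
  by rewrite !mulr_ge0 ?invr_ge0 ?normal_peak_ge0 ?expR_ge0.
rewrite mulrACA mulVf// mul1r /gaussw /normal_fun -expRM_natl -expRD ler_expR.
rewrite subr0 expr1n -(real_normK (num_real u)).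
have := sqr_ge0 (`|u| - 2 * c); set x := `|u|; nra.
Qed.

Lemma integrable_L2_gaussw (f : R -> R[i]) c : L2 f ->
  mu.-integrable [set: R] (EFin \o (fun u => gaussw c u * normc (f u))).
Proof.
move=> Lf; have mf := measurable_normc (L2_measurable Lf).
have H := integrableD measurableT
  (integrable_gaussw_sqr c) (L2_integrable_sqr Lf).
apply: le_integrable H => //.
  by apply/measurable_EFinP; apply: measurable_funM => //; exact: measurable_gaussw.
move=> u _; rewrite lee_fin/= !ger0_norm
  ?mulr_ge0 ?addr_ge0 ?sqr_ge0 ?expR_ge0 ?normc_ge0//.
have := sqr_ge0 (gaussw c u - normc (f u)).
have := sqr_ge0 (gaussw c u + normc (f u)); nra.
Qed.

End L2_gaussian.

(** * The Segal-Bargmann transform *)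

Section SB_kernel.
Context {R : realType}.
Local Open Scope complex_scope.
Import Normc.
Notation mu := (@lebesgue_measure R).
Implicit Types (z k : R[i]) (u : R) (f : R -> R[i]).
Local Notation s2 := (Num.sqrt 2 : R).

Lemma SBkernelE (x y u : R) : SBkernel (x +i* y) u =
  expC ((- (u ^+ 2 / 2) + s2 * u * x - (x ^+ 2 - y ^+ 2) / 2) +i*
        (s2 * u * y - x * y)).
Proof.
have h2 : 2^-1 = (2^-1 : R)%:C :> R[i] by rewrite fmorphV rmorph_nat.
rewrite /SBkernel; congr expC; rewrite !h2 !expr2; simpc; congr (_ +i* _).
by field.
Qed.

Lemma measurable_SBkernel z : measurableC (SBkernel z).
Proof.
have mu1 : measurableC (fun u : R => u%:C) by exact: measurableC_real.
apply: measurableC_expC; apply: measurableCD; last exact: measurableC_cst.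
apply: measurableCD.
  apply: measurableCN; under eq_fun do rewrite expr2.
  by do 2!apply: measurableCM => //; exact: measurableC_cst.
by do 2!apply: measurableCM => //; exact: measurableC_cst.
Qed.

Lemma SBkernelD z k u :
  SBkernel (z + k) u = SBkernel z u * expC (k * (s2%:C * u%:C - z - k / 2)).
Proof. by rewrite /SBkernel -expCD; congr expC; field. Qed.

Lemma normc_SBkernel_le z u :
  normc (SBkernel z u) <= expR (normc z ^+ 2) * gaussw (s2 * normc z) u.
Proof.
have := normr_Re_le z; have := normr_Im_le z; have := normc_ge0 z.
move: (normc z) => r; case: z => x y r0.
rewrite [complex.Im _]/= [complex.Re _]/= => yr xr.
rewrite SBkernelE normc_expC /gaussw -expRD ler_expR /=.
have s20 : 0 <= s2 by exact: sqrtr_ge0.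
have y2 : y ^+ 2 <= r ^+ 2 by rewrite -real_normK ?num_real// lerXn2r ?nnegrE.
have x2 := sqr_ge0 x; have r2 := sqr_ge0 r.
have : s2 * u * x <= s2 * r * `|u|.
  rewrite -!mulrA ler_wpM2l// (le_trans (ler_norm _))// normrM mulrC.
  by rewrite ler_wpM2r.
lra.
Qed.

(** For [|k| <= 1], [m] bounds [|sqrt 2 u - z - k/2|], the exponent of the increment divided by [k].
    The factor [e^(2m)] leaves room for that increment and for polynomial factors in [m]; it only
    raises the Gaussian parameter from [sqrt 2 |z|] to [sqrt 2 (|z| + 2)]. *)
Lemma normc_SBkernel_gaussw z u (m := s2 * `|u| + normc z + 1) :
  normc (SBkernel z u) * expR (2 * m) <=
  expR (normc z ^+ 2 + 2 * (normc z + 1)) * gaussw (s2 * (normc z + 2)) u.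
Proof.
apply: (le_trans (ler_wpM2r (expR_ge0 _) (normc_SBkernel_le z u))).
by rewrite /gaussw -!expRD ler_expR /m; lra.
Qed.

Lemma expR_sqr_le (m : R) : 0 <= m -> m ^+ 2 <= 2 * expR m.
Proof.
by move=> m0; have := expR_ge1Dxn 1 m0; rewrite !factS fact0 !muln1; lra.
Qed.

(** The function bounded here is the derivative of the kernel in [z]; its linear factor is at most
    [m], hence at most [e^(2m)]. *)
Lemma normc_SBkernel_slope z u :
  normc ((s2%:C * u%:C - z) * SBkernel z u) <=
  expR (normc z ^+ 2 + 2 * (normc z + 1)) * gaussw (s2 * (normc z + 2)) u.
Proof.
apply: le_trans (normc_SBkernel_gaussw z u).
rewrite normcM mulrC ler_wpM2l ?normc_ge0// (le_trans (normcB _ _))//.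
rewrite normcM !normc_real (ger0_norm (sqrtr_ge0 _)).
have z0 := normc_ge0 z; have u0 : 0 <= s2 * `|u| by rewrite mulr_ge0 ?sqrtr_ge0.
have := expR_ge1Dx (2 * (s2 * `|u| + normc z + 1)); lra.
Qed.

Lemma normc_SBkernel_le_gaussw z u : normc (SBkernel z u) <=
  expR (normc z ^+ 2 + 2 * (normc z + 1)) * gaussw (s2 * (normc z + 2)) u.
Proof.
apply: le_trans (normc_SBkernel_gaussw z u).
rewrite ler_peMr ?normc_ge0//.
have z0 := normc_ge0 z; have u0 : 0 <= s2 * `|u| by rewrite mulr_ge0 ?sqrtr_ge0.
have := expR_ge1Dx (2 * (s2 * `|u| + normc z + 1)); lra.
Qed.

(** With [w] the increment of the exponent, [k (sqrt 2 u - z) = w + k^2 / 2], so the remainder is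
    the kernel times [(e^w - 1 - w) - k^2 / 2]. As [|w| <= |k| m] and [m^2 <= 2 e^m], the first part
    is at most [8 |k|^2 e^(2m)] and the second at most [|k|^2 e^(2m)], whence 9. *)
Lemma normc_SBkernel_taylor z k u : normc k <= 1 ->
  normc (SBkernel (z + k) u - SBkernel z u -
         k * ((s2%:C * u%:C - z) * SBkernel z u)) <=
  normc k ^+ 2 * (9 * expR (normc z ^+ 2 + 2 * (normc z + 1))) *
  gaussw (s2 * (normc z + 2)) u.
Proof.
move=> k1; set w := k * (s2%:C * u%:C - z - k / 2).
have -> : SBkernel (z + k) u - SBkernel z u -
    k * ((s2%:C * u%:C - z) * SBkernel z u) =
    SBkernel z u * ((expC w - 1 - w) - k ^+ 2 / 2).
  by rewrite SBkernelD -/w /w; field.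
have k0 := normc_ge0 k; have z0 := normc_ge0 z.
have u0 : 0 <= s2 * `|u| by rewrite mulr_ge0 ?sqrtr_ge0.
have half : normc (2^-1 : R[i]) = 2^-1.
  have -> : 2^-1 = (2^-1 : R)%:C :> R[i] by rewrite fmorphV rmorph_nat.
  by rewrite normc_real ger0_norm.
set m := s2 * `|u| + normc z + 1.
have m0 : 0 <= m by rewrite /m !addr_ge0.
have wm : normc w <= normc k * m.
  rewrite /w normcM ler_wpM2l// (le_trans (normcB _ _))//.
  rewrite normcM half (le_trans (lerD (normcB _ _) (lexx _)))//.
  by rewrite normcM !normc_real (ger0_norm (sqrtr_ge0 _)) /m; lra.
have wm' : normc w <= m by rewrite (le_trans wm)// ler_piMl.
rewrite normcM.
have := normc_SBkernel_gaussw z u; rewrite -/m => key.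
have nK := normc_ge0 (SBkernel z u).
have T : normc (expC w - 1 - w - k ^+ 2 / 2) <= normc k ^+ 2 * (9 * expR (2 * m)).
  rewrite (le_trans (normcB _ _))// normcM half expr2 normcM -expr2.
  rewrite (le_trans (lerD (normc_expC_taylor w) (lexx _)))//.
  have e1 : 1 <= expR m by rewrite -expR0 ler_expR.
  have e2 : expR (2 * m) = expR m * expR m by rewrite mulr2n mulrDl mul1r expRD.
  have e3 : expR (normc w) <= expR m by rewrite ler_expR.
  have e4 : normc w ^+ 2 <= normc k ^+ 2 * m ^+ 2.
    by rewrite -exprMn lerXn2r ?nnegrE ?mulr_ge0// normc_ge0.
  have e5 := expR_sqr_le m0.
  have e6 : normc w ^+ 2 * expR (normc w) <= normc k ^+ 2 * (2 * expR m) * expR m.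
    apply: ler_pM; rewrite ?sqr_ge0 ?expR_ge0//.
    by rewrite (le_trans e4)// ler_wpM2l ?sqr_ge0.
  have kk := sqr_ge0 (normc k).
  have e7 : normc k ^+ 2 <= normc k ^+ 2 * expR (2 * m).
    by rewrite ler_peMr// e2; nra.
  rewrite e2 in e7 *; lra.
apply: (le_trans (ler_wpM2l nK T)).
have kk := sqr_ge0 (normc k).
have := ler_wpM2l kk key; lra.
Qed.

Lemma integrableC_L2_dominated (H : R -> R[i]) f (C c : R) :
  measurableC H -> (forall u, normc (H u) <= C * gaussw c u) -> L2 f ->
  integrableC (fun u => H u * f u).
Proof.
move=> mH HC Lf; have mf := L2_measurable Lf.
have ig := integrableM_cst C (integrable_L2_gaussw c Lf).
apply: (integrableC_le _ ig); first exact: measurableCM.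
by move=> u; rewrite normcM mulrA ler_wpM2r ?normc_ge0.
Qed.

Lemma SB_holomorphic f : L2 f -> holomorphic (SB f).
Proof.
move=> Lf z; have mf := L2_measurable Lf.
pose C := 9 * expR (normc z ^+ 2 + 2 * (normc z + 1)).
pose c := s2 * (normc z + 2).
pose dK u := (s2%:C * u%:C - z) * SBkernel z u.
have mdK : measurableC dK.
  apply: measurableCM; last exact: measurable_SBkernel.
  apply: measurableCD; last exact: measurableC_cst.
  by apply: measurableCM; [exact: measurableC_cst|exact: measurableC_real].
have idK : integrableC (fun u => dK u * f u).
  exact: integrableC_L2_dominated mdK (normc_SBkernel_slope z) Lf.
have iK w : integrableC (fun u => SBkernel w u * f u).
  exact: integrableC_L2_dominated (measurable_SBkernel w)
    (normc_SBkernel_le_gaussw w) Lf.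
(* [D] is the candidate derivative, obtained by differentiating under the integral; the 2 in [M] is
   that of [normc_integralC_le]. *)
pose D := integralC (fun u => dK u * f u).
pose M := 2 * (C * \int[mu]_u (gaussw c u * normc (f u))).
have M0 : 0 <= M.
  rewrite !mulr_ge0 ?expR_ge0// Rintegral_ge0// => u _.
  by rewrite mulr_ge0 ?expR_ge0 ?normc_ge0.
have key k : normc k <= 1 ->
    normc (SB f (z + k) - SB f z - k * D) <= normc k ^+ 2 * M.
  move=> k1.
  have -> : SB f (z + k) - SB f z - k * D = integralC (fun u =>
      (SBkernel (z + k) u - SBkernel z u - k * dK u) * f u).
    have -> : (fun u => (SBkernel (z + k) u - SBkernel z u - k * dK u) * f u) =
      (fun u => SBkernel (z + k) u * f u + ((-1) * (SBkernel z u * f u) +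
         (- k) * (dK u * f u))).
      by apply/funext => u; ring.
    have iB := integrableCZ (-1) (iK z); have iE := integrableCZ (- k) idK.
    rewrite (integralCD (iK (z + k)) (integrableCD iB iE)) (integralCD iB iE).
    by rewrite !integralCZ// /SB /D; ring.
  have iM := integrableM_cst (normc k ^+ 2 * C) (integrable_L2_gaussw c Lf).
  apply: le_trans (normc_integralC_le _ iM _) _.
  - apply: measurableCM => //; apply: measurableCD.
      apply: measurableCD; first exact: measurable_SBkernel.
      by apply: measurableCN; exact: measurable_SBkernel.
    by apply: measurableCN; apply: measurableCM => //; exact: measurableC_cst.
  - move=> u; rewrite normcM mulrA ler_wpM2r ?normc_ge0//.
    exact: normc_SBkernel_taylor.
  - rewrite RintegralZl//; last exact: integrable_L2_gaussw.
    by rewrite /M le_eqVlt; apply/orP; left; apply/eqP; ring.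
apply/cvg_ex; exists (D : R[i]^o); apply/cvgrPdist_le => e e0.
(* The difference quotient differs from [D] by at most [|h| M]. Adding 1 keeps the denominator
   positive when [M] is 0. *)
have e1 : 0 < e / (M%:C + 1).
  by rewrite divr_gt0// ltr_wpDl// ler0c.
near=> h.
have h0 : h != 0 by near: h; exact: nbhs_dnbhs_neq.
have h1 : normc h <= 1.
  rewrite -lecR; near: h; exact: (dnbhs0_le ltr01).
have he : `|h| <= e / (M%:C + 1).
  by near: h; exact: (dnbhs0_le e1).
rewrite /= -normrN opprB.
have -> : h^-1 *: (SB f (h *: 1 + z) - SB f z) - D =
    h^-1 * (SB f (z + h) - SB f z - h * D) :> R[i].
  rewrite [h *: 1]mulr1 (addrC h z) mulrBr mulKf//.
rewrite normrM normfV ler_pdivrMl ?normr_gt0//.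
have kh := key h h1.
apply: (@le_trans _ _ (`|h| ^+ 2 * M%:C)).
  rewrite !normCE -rmorphXn -rmorphM lecR //.
rewrite expr2 -mulrA ler_wpM2l//.
apply: (@le_trans _ _ (`|h| * (M%:C + 1))).
  by rewrite ler_wpM2l// lerDl.
by rewrite -ler_pdivlMr// ltr_wpDl// ler0c.
Unshelve. all: by end_near. Qed.

End SB_kernel.

(** * Injectivity through the Fourier transform *)

Section SB_injective.
Context {R : realType}.
Local Open Scope complex_scope.
Import Normc.
Notation mu := (@lebesgue_measure R).
Implicit Types (f g h : R -> R[i]).

Lemma SBkernel_imaginary (t u : R) : SBkernel (0 +i* (t / Num.sqrt 2)) u =
  (expR (t ^+ 2 / 4))%:C * ((cos (t * u) +i* sin (t * u)) * (gaussw 0 u)%:C).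
Proof.
have s20 : Num.sqrt 2 != 0 :> R by rewrite gt_eqF// sqrtr_gt0.
have s22 : Num.sqrt 2 ^+ 2 = 2 :> R by rewrite sqr_sqrtr.
rewrite SBkernelE /expC /=.
have -> : - (u ^+ 2 / 2) + Num.sqrt 2 * u * 0 -
    (0 ^+ 2 - (t / Num.sqrt 2) ^+ 2) / 2 =
    t ^+ 2 / 4 + (- (u ^+ 2 / 2) + 0 * `|u|).
  by rewrite exprMn exprVn s22; field.
have -> : Num.sqrt 2 * u * (t / Num.sqrt 2) - 0 * (t / Num.sqrt 2) = t * u.
  by field.
by rewrite expRD /gaussw rmorphM/=; ring.
Qed.

(** Each [t] gives two real equations linking the cosine and sine integrals of the real and
    imaginary parts of [h]. Replacing [t] by [- t] flips the sign of the sine integrals only, so all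
    four vanish, and the real uniqueness result applies to both parts. *)
Lemma fourier_eq0 h : integrableC h ->
  (forall t : R, integralC (fun u => (cos (t * u) +i* sin (t * u)) * h u) = 0) ->
  h = cst 0 %[ae mu].
Proof.
move=> [h1 h2] F0.
pose h_ (b : bool) u := if b then complex.Im (h u) else complex.Re (h u).
have ih b : mu.-integrable [set: R] (EFin \o h_ b) by case: b.
have cosh (b : bool) t : mu.-integrable [set: R]
    (EFin \o (fun u => cos (t * u) * h_ b u)).
  apply: (@integrable_bounded_mul _ _ _ 1) => //.
    have -> : (fun u => cos (t * u)) = (fun u => cos (t * u + 0)).
      by apply/funext => u; rewrite addr0.
    exact: measurable_cos_affine.
  by move=> u; rewrite ler_norml cos_geN1 cos_le1.
have sinh (b : bool) t : mu.-integrable [set: R]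
    (EFin \o (fun u => sin (t * u) * h_ b u)).
  apply: (@integrable_bounded_mul _ _ _ 1) => //; last by move=> u; exact: sin_max.
  have -> : (fun u => sin (t * u)) = (fun u => cos (t * u + - (pi / 2))).
    by apply/funext => u; rewrite cosBpihalf.
  exact: measurable_cos_affine.
have E t : \int[mu]_u (cos (t * u) * h_ false u) -
             \int[mu]_u (sin (t * u) * h_ true u) = 0 /\
           \int[mu]_u (cos (t * u) * h_ true u) +
             \int[mu]_u (sin (t * u) * h_ false u) = 0.
  have := F0 t; rewrite /integralC => -[E1 E2].
  split.
    by rewrite -RintegralB// -[RHS]E1; under [RHS]eq_Rintegral do rewrite ReM.
  by rewrite -RintegralD// -[RHS]E2; under [RHS]eq_Rintegral do rewrite ImM.
have EN b t : \int[mu]_u (cos (- t * u) * h_ b u) =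
    \int[mu]_u (cos (t * u) * h_ b u).
  by under eq_Rintegral do rewrite mulNr cosN.
have EN' b t : \int[mu]_u (sin (- t * u) * h_ b u) =
    - \int[mu]_u (sin (t * u) * h_ b u).
  under eq_Rintegral do rewrite mulNr sinN mulNr -mulN1r.
  by rewrite RintegralZl// mulN1r.
have cs0 b t : \int[mu]_u (cos (t * u) * h_ b u) = 0 /\
    \int[mu]_u (sin (t * u) * h_ b u) = 0.
  have := E t; have := E (- t); rewrite !EN !EN' => -[? ?] [? ?].
  by case: b; split; lra.
have H b s th : \int[mu]_u (cos (s * u + th) * h_ b u) = 0.
  have X u : cos (s * u + th) * h_ b u =
      cos th * (cos (s * u) * h_ b u) - sin th * (sin (s * u) * h_ b u).
    by rewrite cosD; ring.
  under eq_Rintegral do rewrite X.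
  rewrite RintegralB//; [|exact: integrableM_cst..].
  rewrite !RintegralZl//; have [-> ->] := cs0 b s; ring.
have := cos_transform_eq0 (ih true) (H true).
have := cos_transform_eq0 (ih false) (H false).
apply: filterS2; first exact: (ae_filter_ringOfSetsType mu).
move=> u /= Re0 Im0 _; move: (Re0 Logic.I) (Im0 Logic.I).
by rewrite /h_; case: (h u) => a b /= -> ->.
Qed.

Lemma SB_injective f g : L2 f -> L2 g -> SB f = SB g -> f = g %[ae mu].
Proof.
move=> Lf Lg SBfg.
have mw : measurableC (fun u : R => (gaussw 0 u)%:C).
  exact: measurableC_real (measurable_gaussw 0).
have iw f' : L2 f' -> integrableC (fun u => (gaussw 0 u)%:C * f' u).
  apply: (@integrableC_L2_dominated _ _ _ 1 0) => //.
  by move=> u; rewrite normc_real ger0_norm ?expR_ge0// mul1r.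
have iK f' z : L2 f' -> integrableC (fun u => SBkernel z u * f' u).
  exact: integrableC_L2_dominated (measurable_SBkernel z)
    (normc_SBkernel_le_gaussw z).
(* The weighted difference of [f] and [g], kept as a sum of two terms, each integrable by the L_2
   hypothesis on one function. *)
pose h u := (gaussw 0 u)%:C * f u + (-1) * ((gaussw 0 u)%:C * g u).
have ih : integrableC h.
  by apply: integrableCD; [exact: iw|apply: integrableCZ; exact: iw].
have : h = cst 0 %[ae mu].
  apply: fourier_eq0 => // t.
  have e0 : (expR (t ^+ 2 / 4))%:C != 0 :> R[i].
    by rewrite eq_complex/= negb_and gt_eqF ?expR_gt0.
  pose z : R[i] := 0 +i* (t / Num.sqrt 2).
  have -> : (fun u => (cos (t * u) +i* sin (t * u)) * h u) =
      (fun u => (expR (t ^+ 2 / 4))%:C^-1 *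
         (SBkernel z u * f u + (-1) * (SBkernel z u * g u))).
    apply/funext => u; rewrite SBkernel_imaginary /h.
    by field.
  have iB := integrableCZ (-1) (iK g z Lg).
  rewrite (integralCZ _ (integrableCD (iK f z Lf) iB)).
  rewrite (integralCD (iK f z Lf) iB) (integralCZ _ (iK g z Lg)).
  by rewrite -/(SB f z) -/(SB g z) SBfg mulN1r subrr mulr0.
apply: filterS; first exact: (ae_filter_ringOfSetsType mu).
(* The Gaussian factor never vanishes, so [h u = 0] forces [f u = g u]. *)
move=> u /= /(_ Logic.I) + _; rewrite /h mulN1r -mulrBr => /eqP.
rewrite mulf_eq0 subr_eq0 => /orP[|/eqP//].
by rewrite eq_complex/= gt_eqF ?expR_gt0.
Qed.

End SB_injective.

Theorem theorem6p2p3 (R : realType) :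
  (forall f : R -> R[i], L2 f -> holomorphic (SB f)) /\
  (forall f g : R -> R[i], L2 f -> L2 g -> SB f = SB g ->
     f = g %[ae @lebesgue_measure R]).
Proof. by split=> [f|f g]; [exact: SB_holomorphic|exact: SB_injective]. Qed.
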